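(* Consider the sender-receiver game $\Gamma$ with data $(K,p,M,X,(U^k)_{k\in K},(V^k)_{k\in K},(u_0^k)_{k\in K})$ described in the context. Assume that $K=\{1,2,3\}$, that the participation structure is $\mathcal{T}^*=\{\{1,3\},\{2,3\}\}$, that the decision set $X$ is compact and convex, and that the utility functions $U^k$ and $V^k$, $k\in K$, are affine. Then $\Gamma$ has a partially revealing equilibrium $(\sigma,\tau)$, in which player 1 uses a mixed, possibly not pure, strategy $\sigma:K\to\Delta(M)$.
   Context: Data of the game $\Gamma$. $K$ is a nonempty finite set of types; $p\in\Delta(K)$ is a prior probability with $p^k>0$ for every $k\in K$; $M$ is a finite set of messages with $|M|\ge|K|$; $X$ is a compact space of decisions (here a compact convex subset of a real topological vector space, e.g. of some $\mathbb{R}^n$); for every $k\in K$, $U^k:X\to\mathbb{R}$ (sender, player 1) and $V^k:X\to\mathbb{R}$ (receiver, player 2) are continuous utility functions and $u_0^k\in\mathbb{R}$ is the sender's outside option. It is assumed that for every $k\in K$ there exists $x\in X$ with $U^k(x)\ge u_0^k$. ($\Delta(S)$ denotes the set of probability distributions on a finite set $S$.) Interpretation: a type $k$ is drawn from $p$ and told to the sender, who sends a message $m\in M$; the receiver then proposes $x\in X$; if the sender accepts, payoffs are $U^k(x),V^k(x)$; if he rejects (exit), he gets $u_0^k$ and the receiver gets $-\infty$. The sender of type $k$ accepts $x$ if and only if $U^k(x)\ge u_0^k$. The receiver's equilibrium expected utility is required to be finite. For $L\subseteq K$ let $X(L)=\{x\in X: U^k(x)\ge u_0^k \ \forall k\in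 L\}$. Let $\mathcal{T}=\{L\subseteq K: L\neq\emptyset,\ X(L)\ne\emptyset\}$. The participation structure $\mathcal{T}^*$ of $\Gamma$ is the set of maximal elements of $\mathcal{T}$ for set inclusion. A strategy of the sender is a map $\sigma:K\to\Delta(M)$, written $\sigma(m\mid k)$; a strategy of the receiver is a map $\tau:M\to X$. Put $P_\sigma(m)=\sum_{k}p^k\sigma(m\mid k)$ and, if $P_\sigma(m)>0$, $p_m^k(\sigma)=p^k\sigma(m\mid k)/P_\sigma(m)$, $p_m(\sigma)=(p_m^k(\sigma))_{k\in K}\in\Delta(K)$, with support $\mathrm{supp}\,p_m(\sigma)\subseteq K$. An equilibrium of $\Gamma$ is a pair $(\sigma,\tau)$ such that (1) (incentive compatibility) $U^k(\tau(m))\ge U^k(\tau(m'))$ for all $k\in K$, all $m\in M$ with $\sigma(m\mid k)>0$ and all $m'\in M$; (2) (constrained optimization, no exit) for every $m\in M$ with $P_\sigma(m)>0$, $X(\mathrm{supp}\,p_m(\sigma))\ne\emptyset$ and $\tau(m)\in\arg\max_{x\in X(\mathrm{supp}\,p_m(\sigma))}\sum_{k}p_m^k(\sigma)V^k(x)$. An equilibrium is nonrevealing if $\sigma(m\mid k)=\sigma(m\mid k')$ for all $m,k,k'$; it is completely revealing if $p_m(\sigma)$ is a Dirac mass for every $m$ with $P_\sigma(m)>0$; it is partially revealing if it is neither nonrevealing nor completely revealing. *)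

(* Defs.v *)
From HB Require Import structures.
From mathcomp Require Import all_boot all_order all_algebra.
From mathcomp Require Import all_classical all_reals all_analysis.

Set Implicit Arguments.
Unset Strict Implicit.
Unset Printing Implicit Defensive.

Import Order.TTheory GRing.Theory Num.Theory.
Import numFieldTopology.Exports.

Local Open Scope classical_set_scope.
Local Open Scope ring_scope.

Record simplex (R : realType) (S : finType) := Simplex {
  mass :> S -> R;
  mass_ge0 : forall s, 0 <= mass s;
  mass_sum1 : \sum_s mass s = 1
}.

(* Utilities are given on the ambient topological vector space, but only their
   values on [decisions] matter. [K] is nonempty because it carries [prior]. *)
Record game (R : realType) (E : topologicalLmodType R) (K M : finType) := Game {
  prior : simplex R K;
  prior_gt0 : forall k, 0 < prior k;
  card_messages : (#|K| <= #|M|)%N;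
  decisions : set E;
  decisions_compact : compact decisions;
  sender_utility : K -> E -> R;
  sender_utility_continuous :
    forall k, {within decisions, continuous (sender_utility k)};
  receiver_utility : K -> E -> R;
  receiver_utility_continuous :
    forall k, {within decisions, continuous (receiver_utility k)};
  outside_option : K -> R;
  outside_option_attained : forall k,
    exists2 x, decisions x & outside_option k <= sender_utility k x
}.

Definition argmax (R : realType) (T : Type) (A : set T) (f : T -> R) : set T :=
  [set x | A x /\ forall y, A y -> f y <= f x].

Definition affine_on (R : realType) (E : lmodType R) (A : set E)
    (f : E -> R) : Prop :=
  forall (x y : E) (t : R), A x -> A y -> 0 <= t <= 1 ->
    f (t *: x + (1 - t) *: y) = t * f x + (1 - t) * f y.

Section Game.
Variables (R : realType) (E : topologicalLmodType R) (K M : finType).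
Variable G : game E K M.

Definition acceptable (L : {set K}) : set E :=
  [set x | decisions G x /\
    forall k, k \in L -> outside_option G k <= sender_utility G k x].

Definition participating : set {set K} :=
  [set L | L != finset.set0 /\ acceptable L !=set0].

Definition participation_structure : set {set K} :=
  [set L | participating L /\
    forall L', participating L' -> L \subset L' -> L' = L].

Section Strategy.
Variable sigma : K -> simplex R M.

Definition message_prob (m : M) : R := \sum_k prior G k * sigma k m.

(* Only meaningful when [0 < message_prob m]. *)
Definition posterior (m : M) (k : K) : R :=
  prior G k * sigma k m / message_prob m.

Definition posterior_supp (m : M) : {set K} :=
  [set k | posterior m k != 0]%SET.

Definition incentive_compatible (tau : M -> E) : Prop :=
  forall k m m', 0 < sigma k m ->
    sender_utility G k (tau m') <= sender_utility G k (tau m).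

Definition constrained_optimal (tau : M -> E) : Prop :=
  forall m, 0 < message_prob m ->
    acceptable (posterior_supp m) !=set0 /\
    argmax (acceptable (posterior_supp m))
      (fun x => \sum_k posterior m k * receiver_utility G k x) (tau m).

(* The first clause says that [tau] is a map from [M] to the decision set. *)
Definition equilibrium (tau : M -> E) : Prop :=
  [/\ forall m, decisions G (tau m),
      incentive_compatible tau
    & constrained_optimal tau].

Definition nonrevealing : Prop := forall m k k', sigma k m = sigma k' m.

Definition completely_revealing : Prop :=
  forall m, 0 < message_prob m ->
    exists k, forall k', posterior m k' = (k' == k)%:R.

Definition partially_revealing : Prop :=
  ~ nonrevealing /\ ~ completely_revealing.

End Strategy.
End Game.

(* The three types 1, 2, 3, encoded as the ordinals 0, 1, 2. *)
Definition type1 : 'I_3 := @Ordinal 3 0 isT.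
Definition type2 : 'I_3 := @Ordinal 3 1 isT.
Definition type3 : 'I_3 := @Ordinal 3 2 isT.

(* Main.v *)
Require Import Defs.
From HB Require Import structures.
From mathcomp Require Import all_boot all_order all_algebra.
From mathcomp Require Import all_classical all_reals all_analysis.
From mathcomp Require Import ring lra.

Set Implicit Arguments.
Unset Strict Implicit.
Unset Printing Implicit Defensive.

Import Order.TTheory GRing.Theory Num.Theory.
Import numFieldTopology.Exports.

Local Open Scope classical_set_scope.
Local Open Scope ring_scope.

(** Types 1 and 2 can never be satisfied together: otherwise the set made of
    these two types would lie in a maximal participating set, that is in {1,3}
    or {2,3}. They are therefore separated by two messages m1 and m2, type 1
    sending m1 and type 2 sending m2, while type 3 sends m1 with some
    probability a and m2 with probability 1 - a. Whatever a is, neither type 1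
    nor type 2 wants to deviate, because the proposal meant for one of them
    lies below the outside option of the other.

    What remains is the choice of a and of the proposals x after m1 and y after
    m2. As long as 0 < a < 1, x has to maximize p1 V1 + a p3 V3 on X({1,3}), y
    has to maximize p2 V2 + (1 - a) p3 V3 on X({2,3}), and type 3 has to be
    indifferent: U3 x = U3 y. For a in [0, 1] consider the optimal pairs (x, y)
    of these two problems. Optima exist by compactness, so the closed set of
    weights having an optimal pair with U3 x >= U3 y and the closed set of
    weights having one with U3 x <= U3 y cover [0, 1]. If 1 is in the first set
    or 0 in the second one, type 3 agrees to send a single message. Otherwise
    both sets are nonempty and, [0, 1] being connected, they meet at some a in
    the interior; the optimal pairs form a convex set on which U3 x - U3 y is
    affine and takes both signs, so it vanishes at one of them. This is
    [balanced_weight], carried to the two decision problems by [balanced_pair].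

    At a = 1 (and symmetrically at a = 0) message m2 reveals type 2, and the
    receiver is only constrained by X({2}), which is larger than X({2,3}).
    [optimum_at_weight] shows that this does no harm: either an optimum on
    X({2}) is unacceptable to type 3, who then likes it less than x, or it lies
    in X({2,3}) and the optimum y found there is still optimal on X({2}).
    [split_equilibrium] assembles the equilibrium; it is partially revealing
    because m1 and m2 separate types 1 and 2, while type 3 shares at least one
    of the two messages with another type. *)

(** * Balancing a one-parameter family of maximization problems *)

Section Compactness.
Variable R : realType.

(** Utilities are continuous on the decision set only, so their superlevel sets
    are not closed in the ambient space; they are traces of closed sets, which
    is what compactness of an intersection needs. *)
Lemma superlevel_trace (T : topologicalType) (A : set T) (f : T -> R) (c : R) :
  {within A, continuous f} ->
  exists2 C : set T, closed C & forall x, A x -> C x <-> c <= f x.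
Proof.
move=> cf; have := (continuous_closedP _).1 cf _ (@closed_ge R c).
move=> /closed_subspaceP[C clC CA]; exists C => // x Ax.
have := congr1 (@^~ x) CA; rewrite /setI /= => e; split=> [Cx|cx].
  by have [] : c <= f x /\ A x by rewrite -e.
by have [] : C x /\ A x by rewrite e.
Qed.

(** The set of parameters is the projection on the first factor of a compact
    subset of [0, 1] * Q: being a maximizer is a family of closed conditions,
    one for each competitor. *)
Lemma argmax_params_closed (T : topologicalType) (Q C : set T)
    (f : R * T -> R) :
  compact Q -> closed C -> continuous f ->
  closed [set a : R | (0 <= a <= 1) /\
    exists2 q, argmax Q (fun q => f (a, q)) q & C q].
Proof.
move=> cQ clC cf.
pose W := (`[0, 1]%classic `*` Q) `&`
  ((\bigcap_(q in Q) [set w : R * T | 0 <= f w - f (w.1, q)]) `&` (snd @^-1` C)).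
have cW : compact W.
  apply: compact_closedI.
    by apply: compact_setX => //; exact: segment_compact.
  apply: closedI.
    apply: closed_bigI => q Qq.
    have ch : continuous (fun w : R * T => f w - f (w.1, q)).
      move=> w; apply: cvgB; first exact: cf.
      apply: (continuous_comp (f := fun w : R * T => (w.1, q))); last exact: cf.
      apply: (@cvg_pair _ _ _ (nbhs w) (nbhs w.1) (nbhs q)).
        exact: cvg_fst.
      exact: cvg_cst.
    exact: ((continuous_closedP _).1 ch _ (@closed_ge R 0)).
  apply: ((continuous_closedP (@snd R T)).1 _ _ clC) => w; exact: cvg_snd.
rewrite [X in closed X](_ : _ = fst @` W).
  apply: compact_closed; first exact: Rhausdorff.
  apply: continuous_compact => //.
  by apply: continuous_subspaceT => w; exact: cvg_fst.
apply/seteqP; split=> [a [a01 [q [Qq maxq] Cq]]|a [[b q] /= [[b01 Qq] [maxq Cq]] <-]].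
  exists (a, q) => //; split; first by split => //=; rewrite in_itv.
  by split=> // q' Qq' /=; rewrite subr_ge0; exact: maxq.
split; first by move: b01; rewrite /= in_itv.
by exists q => //; split=> // q' Qq'; have := maxq _ Qq'; rewrite /= subr_ge0.
Qed.

(** A point of [Q] gathers the value of the objective at weight 0, its slope in
    the weight, and the quantity to be balanced. The sign conditions say that
    this quantity vanishes, except that it may be positive at weight 1 and
    negative at weight 0. *)
Lemma balanced_weight (Q : set (R * R * R)) :
  compact Q -> Q !=set0 ->
  (forall q q' t, Q q -> Q q' -> 0 <= t <= 1 ->
    Q (t * q.1.1 + (1 - t) * q'.1.1, t * q.1.2 + (1 - t) * q'.1.2,
       t * q.2 + (1 - t) * q'.2)) ->
  exists a q, [/\ 0 <= a <= 1, argmax Q (fun q => q.1.1 + a * q.1.2) q,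
    0 < a -> 0 <= q.2 & a < 1 -> q.2 <= 0].
Proof.
move=> cQ nQ convQ.
pose f (w : R * (R * R * R)) : R := w.2.1.1 + w.1 * w.2.1.2.
have cf : continuous f.
  move=> w; apply: cvgD.
    exact: (cvg_comp _ _ (cvg_comp _ _ cvg_snd cvg_fst) cvg_fst).
  apply: cvgM; first exact: cvg_fst.
  exact: (cvg_comp _ _ (cvg_comp _ _ cvg_snd cvg_fst) cvg_snd).
have exmax a : exists q, argmax Q (fun q => f (a, q)) q.
  have cfa : continuous (fun q => f (a, q)).
    move=> q; apply: (continuous_comp (f := fun q => (a, q))); last exact: cf.
    apply: (@cvg_pair _ _ _ (nbhs q) (nbhs a) (nbhs q)); first exact: cvg_cst.
    exact: cvg_id.
  have [|c Qc maxc] := @compact_EVT_max _ _ (fun q => f (a, q)) _ nQ cQ.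
    exact: continuous_subspaceT.
  exists c; split; first exact: set_mem.
  by move=> y Qy; apply: maxc; exact: mem_set.
pose wts (C : set (R * R * R)) := [set a : R | (0 <= a <= 1) /\
    exists2 q, argmax Q (fun q => f (a, q)) q & C q].
pose Pos := wts [set q | 0 <= q.2]; pose Neg := wts [set q | q.2 <= 0].
have csnd : continuous (@snd (R * R) R) by move=> w; exact: cvg_snd.
have clPos : closed Pos.
  apply: argmax_params_closed => //.
  exact: ((continuous_closedP _).1 csnd _ (@closed_ge R 0)).
have clNeg : closed Neg.
  apply: argmax_params_closed => //.
  exact: ((continuous_closedP _).1 csnd _ (@closed_le R 0)).
have cover a : 0 <= a <= 1 -> Pos a \/ Neg a.
  move=> a01; have [q maxq] := exmax a.
  by have [q0|/ltW q0] := leP 0 q.2; [left|right]; split=> //; exists q.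
have [[_ [q maxq q0]]|nPos1] := pselect (Pos 1).
  by exists 1, q; split=> //; rewrite ?ltxx ?ler01 ?lexx.
have [[_ [q maxq q0]]|nNeg0] := pselect (Neg 0).
  by exists 0, q; split=> //; rewrite ?ltxx ?ler01 ?lexx.
(* Disjoint sets [Pos] and [Neg] would make [Pos] clopen in [0, 1]. It contains
   0, so it would be everything and contain 1. *)
have [a [Posa Nega]] : exists a, Pos a /\ Neg a.
  apply: contrapT => disj.
  have PosE : Pos = `[0, 1]%classic `&` ~` Neg.
    apply/seteqP; split=> [a Pa|a [a01 nNa]].
      split; first by rewrite /= in_itv; exact: Pa.1.
      by move=> Na; apply: disj; exists a.
    by have [] := cover a; first by move: a01; rewrite /= in_itv.
  suff PosI : Pos = `[0, 1]%classic.
    by apply: nPos1; rewrite PosI /= in_itv /= ler01 lexx.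
  have /connected_intervalP conn01 := @interval_is_interval R `[0, 1].
  apply: conn01.
  - exists 0; have [] := cover 0 => //; by rewrite lexx ler01.
  - by exists (~` Neg) => //; exact: closed_openC.
  - exists Pos => //; apply/seteqP; split=> [a Pa|a []//].
    by split=> //; rewrite /= in_itv; exact: Pa.1.
have [a01 [q [Qq maxq] /= q0]] := Posa.
have [_ [q' [Qq' maxq'] /= q'0]] := Nega.
(* Maximizers of an affine objective are stable under mixing, and the mixture
   may be chosen to cancel the third coordinate. *)
have [t [t01 tE]] : exists t, 0 <= t <= 1 /\ t * q.2 + (1 - t) * q'.2 = 0.
  have [qq'|qq'] := eqVneq q.2 q'.2.
    by exists 1; rewrite ler01 lexx; split => //; lra.
  exists (- q'.2 / (q.2 - q'.2)).
  have d0 : 0 < q.2 - q'.2 by lra.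
  split; last by field; rewrite gt_eqF.
  by rewrite divr_ge0 ?ler_pdivrMr ?mul1r //=; lra.
pose r := (t * q.1.1 + (1 - t) * q'.1.1, t * q.1.2 + (1 - t) * q'.1.2,
       t * q.2 + (1 - t) * q'.2).
exists a, r; split=> //=; last by rewrite tE.
- split; first exact: convQ.
  move=> y Qy; have := maxq _ Qy; have := maxq' _ Qy.
  rewrite /f /= => h1 h2.
  by move/andP: t01 => [t0 t1]; nra.
- by rewrite tE.
Qed.

End Compactness.

(** * Two decision problems sharing a unit of weight *)

Section Pairs.
Variables (R : realType) (E : topologicalLmodType R).

Lemma convex_setE (A : set E) : convex_set A <->
  forall x y t, A x -> A y -> 0 <= t <= 1 -> A (t *: x + (1 - t) *: y).
Proof.
split=> [cA x y t Ax Ay /andP[t0 t1]|cA x y t /set_mem Ax /set_mem Ay].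
  exact: set_mem (cA x y (Itv01 t0 t1) (mem_set Ax) (mem_set Ay)).
by apply/mem_set; apply: cA => //; rewrite ge0 le1.
Qed.

Lemma within_comp_fst (A B : set E) (f : E -> R) :
  {within A, continuous f} -> {within A `*` B, continuous (f \o fst)}.
Proof.
move=> /subspace_continuousP cf; apply/subspace_continuousP => -[x y] [Ax By].
apply: (@cvg_comp _ _ _ fst f _ (within A (nbhs x)) _ _ (cf x Ax)).
move=> P nP; have nP' : nbhs (x, y) (fun w => A w.1 -> P w.1).
  exact: (@cvg_fst _ _ (nbhs x) (nbhs y) _ _ nP).
by apply: (filterS _ nP') => -[x' y'] /= h [Ax' _]; exact: h.
Qed.

Lemma within_comp_snd (A B : set E) (f : E -> R) :
  {within B, continuous f} -> {within A `*` B, continuous (f \o snd)}.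
Proof.
move=> /subspace_continuousP cf; apply/subspace_continuousP => -[x y] [Ax By].
apply: (@cvg_comp _ _ _ snd f _ (within B (nbhs y)) _ _ (cf y By)).
move=> P nP; have nP' : nbhs (x, y) (fun w => B w.2 -> P w.2).
  exact: (@cvg_snd _ _ (nbhs x) (nbhs y) _ _ nP).
by apply: (filterS _ nP') => -[x' y'] /= h [_ By']; exact: h.
Qed.

(** Maximizing a sum of separate objectives over a product amounts to maximizing
    each of them, so the two problems become a single one on [A `*` B], whose
    objective is affine in the weight. Only the image of this product in the
    space of payoffs matters, which brings the question to [balanced_weight]. *)
Lemma balanced_pair (A B : set E) (f1 f2 h g : E -> R) :
  compact A -> A !=set0 -> convex_set A ->
  compact B -> B !=set0 -> convex_set B ->
  affine_on A f1 -> affine_on A h -> affine_on A g ->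
  affine_on B f2 -> affine_on B h -> affine_on B g ->
  {within A, continuous f1} -> {within A, continuous h} ->
  {within A, continuous g} -> {within B, continuous f2} ->
  {within B, continuous h} -> {within B, continuous g} ->
  exists (a : R) x y, [/\ 0 <= a <= 1,
    argmax A (fun x => f1 x + a * h x) x,
    argmax B (fun y => f2 y + (1 - a) * h y) y,
    0 < a -> g y <= g x & a < 1 -> g x <= g y].
Proof.
move=> cA [xA AxA] /convex_setE convA cB [xB BxB] /convex_setE convB.
move=> f1A hA gA f2B hB gB cf1 chA cgA cf2 chB cgB.
pose F (w : E * E) : R * R * R :=
  (* f2 + (1 - a) h is the part f2 + h of weight 0 minus a times h *)
  (f1 w.1 + (f2 w.2 + h w.2), h w.1 - h w.2, g w.1 - g w.2).
have cF : {within A `*` B, continuous F}.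
  have c1 := @within_comp_fst A B; have c2 := @within_comp_snd A B.
  move=> w.
  apply: (@cvg_pair _ _ _ _ (nbhs (F w).1) (nbhs (F w).2)).
    apply: (@cvg_pair _ _ _ _ (nbhs (F w).1.1) (nbhs (F w).1.2)).
      by apply: cvgD; [exact: (c1 _ cf1)|apply: cvgD; exact: c2].
    by apply: cvgB; [exact: (c1 _ chA)|exact: (c2 _ chB)].
  by apply: cvgB; [exact: (c1 _ cgA)|exact: (c2 _ cgB)].
have [|||a [q [a01 [[[x y] [/= Ax By] <-] maxq] q0 q1]]] :=
    @balanced_weight R (F @` (A `*` B)).
- by apply: continuous_compact => //; exact: compact_setX.
- by exists (F (xA, xB)); exists (xA, xB).
- move=> _ _ t [[x y] [/= Ax By] <-] [[x' y'] [/= Ax' By'] <-] t01.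
  exists (t *: x + (1 - t) *: x', t *: y + (1 - t) *: y').
    by split; [exact: convA|exact: convB].
  rewrite /F /= f1A // (hA x) // (gA x) // f2B // (hB y) // (gB y) //.
  by congr (_, _, _); ring.
exists a, x, y; split=> //.
- split=> // z Az; have /= := maxq (F (z, y)) (ex_intro2 _ _ (z, y) (conj Az By) erefl).
  lra.
- split=> // z Bz; have /= := maxq (F (x, z)) (ex_intro2 _ _ (x, z) (conj Ax Bz) erefl).
  lra.
- by move=> /q0; rewrite /= subr_ge0.
- by move=> /q1; rewrite /= subr_le0.
Qed.

End Pairs.

(** * Acceptable decisions and constrained optima *)

Section Game.
Variables (R : realType) (E : topologicalLmodType R) (K M : finType).
Variable G : game E K M.

Local Notation p := (prior G).
Local Notation U := (sender_utility G).
Local Notation V := (receiver_utility G).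
Local Notation u0 := (outside_option G).
Local Notation X := (acceptable G).

Lemma acceptable_sub (L L' : {set K}) : L \subset L' -> X L' `<=` X L.
Proof. by move=> /fintype.subsetP LL' x [Dx x0]; split=> // k /LL'; exact: x0. Qed.

Lemma acceptable_compact (L : {set K}) : compact (X L).
Proof.
have tr k : {C : set E | closed C /\
    forall x, decisions G x -> C x <-> u0 k <= U k x}.
  apply: cid; have [C clC CE] := superlevel_trace (u0 k)
    (@sender_utility_continuous _ _ _ _ G k).
  by exists C.
have -> : X L = decisions G `&` \bigcap_(k in [set` L]) sval (tr k).
  apply/seteqP; split=> x [Dx xL]; split=> // k kL;
    by have [_ /(_ x Dx) xE] := svalP (tr k); apply/xE; exact: xL.
apply: compact_closedI; first exact: decisions_compact.
by apply: closed_bigI => k _; have [] := svalP (tr k).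
Qed.

Lemma acceptable_convex (L : {set K}) : convex_set (decisions G) ->
  (forall k, affine_on (decisions G) (U k)) -> convex_set (X L).
Proof.
move=> /convex_setE convD affU; apply/convex_setE => x y t [Dx xL] [Dy yL] t01.
split; first exact: convD.
move=> k kL; rewrite affU //.
have := xL _ kL; have := yL _ kL; move: t01 => /andP[t0 t1]; nra.
Qed.

(** There are finitely many sets of types, so a participating one can be enlarged
    until it is maximal. *)
Lemma participating_maximal (L : {set K}) : participating G L ->
  exists2 L', participation_structure G L' & L \subset L'.
Proof.
move=> PL; have [|L' /maxsetP[/asboolP PL' maxL'] LL'] :=
  @maxset_exists K (fun L => `[< participating G L >]) L; first exact/asboolP.
exists L' => //; split=> // L'' PL'' sub.
by apply: maxL' => //; exact/asboolP.
Qed.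

Lemma acceptable_outside_structure (L : {set K}) :
  L != finset.set0 -> (forall L', participation_structure G L' -> ~~ (L \subset L')) ->
  X L = set0.
Proof.
move=> L0 notsub; apply/eqP/negPn/negP => /set0P XL.
have [L' sL' LL'] := @participating_maximal L (conj L0 XL).
by have := notsub _ sL'; rewrite LL'.
Qed.

(** This is the source of the incentive constraints: a proposal meant for [j]
    never tempts [i]. *)
Lemma outside_lt_of_incompatible (i j : K) (x : E) :
  X [set i; j]%SET = set0 -> X [set j]%SET x -> U i x < u0 i.
Proof.
move=> X0 [Dx xj]; rewrite ltNge; apply/negP => xi.
suff : X [set i; j]%SET x by rewrite X0.
by split=> // k /set2P[->|->] //; apply: xj; exact: set11.
Qed.

(** The acceptance constraint of [l] disappears when [l] gets weight 0. Every
    maximizer on the larger set that [l] would still accept lies in the smaller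
    set, and then the maximizer [x] found there does equally well; if a maximizer
    is not accepted by [l], its utility to [l] is below [u0 l], hence below [u]. *)
Lemma optimum_at_weight (i l : K) (b u : R) (x : E) :
  argmax (X [set i; l]%SET) (fun x => p i * V i x + b * (p l * V l x)) x ->
  (b = 0 -> U l x <= u) -> u0 l <= u ->
  exists z, [/\ argmax (X (if b == 0 then [set i]%SET else [set i; l]%SET))
      (fun x => p i * V i x + b * (p l * V l x)) z,
    b != 0 -> z = x & b = 0 -> U l z <= u].
Proof.
move=> [Xx xmax] xu lu; have [b0|b0] := eqVneq b 0; last first.
  by exists x; split=> // e; rewrite e eqxx in b0.
subst b; have {}xu := xu erefl.
have {}xmax w : X [set i; l]%SET w -> V i w <= V i x.
  by move=> /xmax; rewrite !mul0r !addr0 ler_pM2l ?prior_gt0.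
have sub : X [set i; l]%SET `<=` X [set i]%SET.
  by apply: acceptable_sub; rewrite finset.sub1set !inE eqxx.
have [||z /set_mem Xz zmax] := compact_EVT_max _ (@acceptable_compact [set i]%SET)
    (f := V i).
- by exists x; exact: sub.
- apply: continuous_subspaceW (@receiver_utility_continuous _ _ _ _ G i).
  by move=> w [].
have best w : V i z <= V i w -> X [set i]%SET w ->
    argmax (X [set i]%SET) (fun x => p i * V i x + 0 * (p l * V l x)) w.
  move=> zw Xw; split=> // v /mem_set /zmax vz.
  by rewrite !mul0r !addr0 ler_pM2l ?prior_gt0 //; exact: le_trans zw.
have [zl|zl] := leP (u0 l) (U l z); last first.
  by exists z; split=> //; [exact: best|lra].
exists x; split=> //; apply: best; last exact: sub.
apply: xmax; case: Xz => [Dz zi].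
by split=> // k /set2P[->|->] //; apply: zi; exact: set11.
Qed.

Lemma message_prob_gt0 (sigma : K -> simplex R M) (m : M) (k : K) :
  sigma k m != 0 -> 0 < message_prob G sigma m.
Proof.
move=> sk; rewrite /message_prob (bigD1 k) //= ltr_wpDr //.
  by apply: sumr_ge0 => k' _; apply: mulr_ge0; exact: mass_ge0.
by rewrite mulr_gt0 ?prior_gt0 // lt_def sk mass_ge0.
Qed.

Lemma posterior_eq0 (sigma : K -> simplex R M) (m : M) (k : K) :
  0 < message_prob G sigma m ->
  (posterior G sigma m k == 0) = (sigma k m == 0).
Proof.
move=> Pgt0; rewrite /posterior !mulf_eq0 invr_eq0 (gt_eqF Pgt0) orbF.
by rewrite (gt_eqF (prior_gt0 G k)).
Qed.

(** If [i] surely sends [m] and [l] is the only other possible sender, then the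
    posterior expectation is the objective below divided by the probability of
    [m], which does not affect the maximizers. *)
Lemma two_type_optimal (sigma : K -> simplex R M) (m : M) (i l : K) (x : E) :
  i != l -> (forall k, k != i -> k != l -> sigma k m = 0) -> sigma i m = 1 ->
  argmax (X (if sigma l m == 0 then [set i]%SET else [set i; l]%SET))
    (fun x => p i * V i x + sigma l m * (p l * V l x)) x ->
  X (posterior_supp G sigma m) !=set0 /\
  argmax (X (posterior_supp G sigma m))
    (fun x => \sum_k posterior G sigma m k * V k x) x.
Proof.
move=> il off si xmax.
have Pgt0 : 0 < message_prob G sigma m.
  by apply: (@message_prob_gt0 _ _ i); rewrite si oner_eq0.
have suppE : posterior_supp G sigma m =
    if sigma l m == 0 then [set i]%SET else [set i; l]%SET.
  apply/setP => k; rewrite inE posterior_eq0 //.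
  have [->|ki] := eqVneq k i.
    by rewrite si oner_eq0; case: ifP => _; rewrite !inE eqxx.
  have [->|kl] := eqVneq k l.
    by case: ifP => sl; rewrite !inE ?eqxx ?orbT //= eq_sym (negbTE il).
  by rewrite off // eqxx; case: ifP => _; rewrite !inE (negbTE ki) ?(negbTE kl).
have payE z : \sum_k posterior G sigma m k * V k z =
    (p i * V i z + sigma l m * (p l * V l z)) / message_prob G sigma m.
  rewrite (bigD1 i) //= (bigD1 l) ?(eq_sym l) //= big1 ?addr0.
    by rewrite /posterior si; field; rewrite gt_eqF.
  by move=> k /andP[ki kl]; rewrite /posterior off // mulr0 !mul0r.
rewrite suppE; split; first by exists x; exact: xmax.1.
split; first exact: xmax.1.
move=> y Xy; rewrite !payE ler_pM2r ?invr_gt0 //; exact: xmax.2.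
Qed.

End Game.

(** * Assembling the equilibrium *)

Section TwoPoint.
Variables (R : realType) (M : finType) (m1 m2 : M).

Definition two_point_mass (a : R) (m : M) : R :=
  a * (m == m1)%:R + (1 - a) * (m == m2)%:R.

Lemma two_point_mass_ge0 (a : {i01 R}) m : 0 <= two_point_mass a%:num m.
Proof.
by rewrite addr_ge0 // mulr_ge0 // subr_ge0.
Qed.

Lemma two_point_mass_sum1 a : \sum_m two_point_mass a m = 1.
Proof.
have dirac (m0 : M) : \sum_m (m == m0)%:R = 1 :> R.
  by rewrite (bigD1 m0) //= eqxx big1 ?addr0 // => m /negbTE ->.
by rewrite big_split /= -!mulr_sumr !dirac !mulr1 addrC subrK.
Qed.

Definition two_point (a : {i01 R}) : simplex R M :=
  Simplex (two_point_mass_ge0 a) (two_point_mass_sum1 a%:num).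

Hypothesis m12 : m1 != m2.

Lemma two_point_fst a : two_point a m1 = a%:num.
Proof. by rewrite /= /two_point_mass eqxx (negbTE m12) mulr1 mulr0 addr0. Qed.

Lemma two_point_snd a : two_point a m2 = 1 - a%:num.
Proof. by rewrite /= /two_point_mass eqxx eq_sym (negbTE m12) mulr1 mulr0 add0r. Qed.

Lemma two_point_off a m : m != m1 -> m != m2 -> two_point a m = 0.
Proof. by rewrite /= /two_point_mass => /negbTE-> /negbTE->; rewrite !mulr0 addr0. Qed.

End TwoPoint.

Section SplitEquilibrium.
Variables (R : realType) (E : topologicalLmodType R) (M : finType).
Variables (G : game E 'I_3 M) (m1 m2 : M).

Lemma type_cases (k : 'I_3) : [\/ k = type1, k = type2 | k = type3].
Proof.
by case: k => -[|[|[|//]]] ?; [apply: Or31|apply: Or32|apply: Or33];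
    exact: val_inj.
Qed.

Definition first_message_weight (a : {i01 R}) (k : 'I_3) : {i01 R} :=
  if k == type1 then Itv01 ler01 (lexx 1)
  else if k == type2 then Itv01 (lexx 0) ler01 else a.

Definition split_message (a : {i01 R}) (k : 'I_3) : simplex R M :=
  two_point m1 m2 (first_message_weight a k).

(** Messages that are never sent are answered as [m2], so that they offer no
    deviation beyond the two proposals in use. *)
Definition split_proposal (x y : E) (m : M) : E := if m == m1 then x else y.

(** The incentive constraints of types 1 and 2 follow from their incompatibility;
    the last two hypotheses are those of type 3 for the messages it uses. *)
Lemma split_equilibrium (a : R) (a0 : 0 <= a) (a1 : a <= 1) (x y : E) :
  m1 != m2 -> acceptable G [set type1; type2]%SET = set0 ->
  argmax (acceptable G (if a == 0 then [set type1] else [set type1; type3])%SET)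
    (fun x => prior G type1 * receiver_utility G type1 x +
              a * (prior G type3 * receiver_utility G type3 x)) x ->
  argmax (acceptable G
      (if 1 - a == 0 then [set type2] else [set type2; type3])%SET)
    (fun y => prior G type2 * receiver_utility G type2 y +
              (1 - a) * (prior G type3 * receiver_utility G type3 y)) y ->
  (0 < a -> sender_utility G type3 y <= sender_utility G type3 x) ->
  (a < 1 -> sender_utility G type3 x <= sender_utility G type3 y) ->
  equilibrium G (split_message (Itv01 a0 a1)) (split_proposal x y) /\
  partially_revealing G (split_message (Itv01 a0 a1)).
Proof.
move=> m12 X12 xmax ymax xy3 yx3.
have x1 : acceptable G [set type1]%SET x.
  apply: (acceptable_sub _ xmax.1).
  by case: ifP => _; rewrite finset.sub1set !inE eqxx.
have y2 : acceptable G [set type2]%SET y.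
  apply: (acceptable_sub _ ymax.1).
  by case: ifP => _; rewrite finset.sub1set !inE eqxx.
pose w := first_message_weight (Itv01 a0 a1).
set sigma := split_message _; set tau := split_proposal x y.
have sigma1 k : sigma k m1 = (w k)%:num by exact: two_point_fst.
have sigma2 k : sigma k m2 = 1 - (w k)%:num by exact: two_point_snd.
have sigma0 k m : m != m1 -> m != m2 -> sigma k m = 0 by exact: two_point_off.
have tau1 : tau m1 = x by rewrite /tau /split_proposal eqxx.
have tau2 : tau m2 = y by rewrite /tau /split_proposal eq_sym (negbTE m12).
have w1 : (w type1)%:num = 1 by [].
have w2 : (w type2)%:num = 0 by [].
have w3 : (w type3)%:num = a by [].
have y1 : sender_utility G type1 y < outside_option G type1.
  exact: outside_lt_of_incompatible X12 y2.
have x2 : sender_utility G type2 x < outside_option G type2.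
  by apply: outside_lt_of_incompatible x1; rewrite finset.setUC.
have x11 := x1.2 type1 (set11 _).
have y22 := y2.2 type2 (set11 _).
have used m : (exists k, sigma k m != 0) -> m = m1 \/ m = m2.
  move=> [k]; have [->|mm1] := eqVneq m m1; first by left.
  have [->|mm2] := eqVneq m m2; first by right.
  by rewrite sigma0 // eqxx.
split; first split.
- by move=> m; rewrite /tau /split_proposal; case: ifP => _;
    [exact: x1.1|exact: y2.1].
- move=> k m m' skm; have tau' : tau m' = x \/ tau m' = y.
    by rewrite /tau /split_proposal; case: ifP => _; [left|right].
  have [|em|em] := used m; first by exists k; rewrite gt_eqF.
    move: skm; rewrite em tau1 sigma1.
    have [->|->|->] := type_cases k; rewrite ?w1 ?w2 ?w3 ?ltxx // => hk;
      case: tau' => -> //; [lra | exact: xy3].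
  move: skm; rewrite em tau2 sigma2.
  have [->|->|->] := type_cases k; rewrite ?w1 ?w2 ?w3 ?subrr ?ltxx // => hk;
    case: tau' => -> //; [lra | apply: yx3; lra].
- move=> m Pm; have [|->|->] := used m.
  + apply: contrapT => nex; move: Pm; rewrite /message_prob big1 ?ltxx // => k _.
    have [->|sk] := eqVneq (sigma k m) 0; first by rewrite mulr0.
    by case: nex; exists k.
  + rewrite tau1; apply: (@two_type_optimal _ _ _ _ G sigma m1 type1 type3).
    * by [].
    * by move=> k; have [->|->|->] := type_cases k; rewrite ?eqxx // sigma1 w2.
    * by rewrite sigma1 w1.
    * by rewrite sigma1 w3.
  + rewrite tau2; apply: (@two_type_optimal _ _ _ _ G sigma m2 type2 type3).
    * by [].
    * by move=> k; have [->|->|->] := type_cases k; rewrite ?eqxx // sigma2 w1 subrr.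
    * by rewrite sigma2 w2 subr0.
    * by rewrite sigma2 w3.
split=> [nonrev|comprev].
  by have := nonrev m1 type1 type2; rewrite !sigma1 w1 w2; lra.
(* A message sent by two types has a posterior that is not a Dirac mass. *)
have pooled m k l : k != l -> sigma k m != 0 -> sigma l m != 0 -> False.
  move=> kl sk sl; have Pgt0 := message_prob_gt0 G sk.
  have [k0 dirac] := comprev m Pgt0.
  have := sk; have := sl; rewrite -!(posterior_eq0 _ Pgt0).
  rewrite !dirac !pnatr_eq0 !eqb0 !negbK.
  by move=> /eqP el /eqP ek; rewrite ek el eqxx in kl.
have [a_0|a_0] := eqVneq a 0.
  apply: (pooled m2 type2 type3); rewrite // sigma2 ?w2 ?w3 ?a_0 subr0 oner_eq0 //.
by apply: (pooled m1 type1 type3); rewrite // sigma1 ?w1 ?w3 ?oner_eq0.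
Qed.

End SplitEquilibrium.

Theorem proposition9 (R : realType) (E : topologicalLmodType R) (M : finType)
    (G : game E 'I_3 M)
    (participationG : participation_structure G =
       [set [set type1; type3]%SET; [set type2; type3]%SET])
    (convexG : convex_set (decisions G))
    (affineU : forall k, affine_on (decisions G) (sender_utility G k))
    (affineV : forall k, affine_on (decisions G) (receiver_utility G k)) :
  exists (sigma : 'I_3 -> simplex R M) (tau : M -> E),
    equilibrium G sigma tau /\ partially_revealing G sigma.
Proof.
have structureP L : L = [set type1; type3]%SET \/ L = [set type2; type3]%SET ->
    participation_structure G L by rewrite participationG.
have [[_ neA] _] := structureP _ (or_introl erefl).
have [[_ neB] _] := structureP _ (or_intror erefl).
have X12 : acceptable G [set type1; type2]%SET = set0.
  apply: acceptable_outside_structure => [|L].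
    by apply/set0Pn; exists type1; rewrite !inE.
  rewrite participationG => -[->|->]; apply/negP => /fintype.subsetP.
    by move=> /(_ type2); rewrite !inE => /(_ isT).
  by move=> /(_ type1); rewrite !inE => /(_ isT).
have subA L : acceptable G L `<=` decisions G by move=> z [].
have affW L f : affine_on (decisions G) f -> affine_on (acceptable G L) f.
  by move=> ff z w t /subA Dz /subA Dw; exact: ff.
have affZ L k : affine_on (acceptable G L)
    (fun z => prior G k * receiver_utility G k z).
  by apply: affW => z w t Dz Dw t01; rewrite affineV //; ring.
have contZ L k : {within acceptable G L,
    continuous (fun z => prior G k * receiver_utility G k z)}.
  move=> z; apply: cvgM; first exact: cvg_cst.
  exact: (continuous_subspaceW (@subA L) (@receiver_utility_continuous _ _ _ _ G k)).
have contU L k : {within acceptable G L, continuous (sender_utility G k)}.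
  exact: continuous_subspaceW (@subA L) (@sender_utility_continuous _ _ _ _ G k).
have convA L := @acceptable_convex _ _ _ _ G L convexG affineU.
have [a [x0 [y0 [a01 maxx maxy xy yx]]]] := balanced_pair
  (@acceptable_compact _ _ _ _ G [set type1; type3]%SET) neA (convA _)
  (@acceptable_compact _ _ _ _ G [set type2; type3]%SET) neB (convA _)
  (affZ _ type1) (affZ _ type3) (affW _ _ (affineU type3))
  (affZ _ type2) (affZ _ type3) (affW _ _ (affineU type3))
  (contZ _ type1) (contZ _ type3) (contU _ type3)
  (contZ _ type2) (contZ _ type3) (contU _ type3).
have /andP[a0 a1] := a01.
have x0l : outside_option G type3 <= sender_utility G type3 x0.
  by apply: maxx.1.2; rewrite !inE.
have y0l : outside_option G type3 <= sender_utility G type3 y0.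
  by apply: maxy.1.2; rewrite !inE.
have [||x [xmax xE xu]] := optimum_at_weight maxx (u := sender_utility G type3 y0).
- by move=> a_0; apply: yx; lra.
- exact: y0l.
have [||y [ymax yE yu]] := optimum_at_weight maxy (u := sender_utility G type3 x0).
- by move=> a_1; apply: xy; lra.
- exact: x0l.
have xy3 : 0 < a -> sender_utility G type3 y <= sender_utility G type3 x.
  move=> a_gt0; rewrite xE ?gt_eqF //.
  have [a_1|a_1] := eqVneq (1 - a) 0; first exact: yu.
  by rewrite yE //; exact: xy.
have yx3 : a < 1 -> sender_utility G type3 x <= sender_utility G type3 y.
  move=> a_lt1; rewrite yE ?subr_eq0 ?gt_eqF //.
  have [a_0|a_0] := eqVneq a 0; first exact: xu.
  by rewrite xE //; apply: yx.
have [m1 [m2 m12]] : exists m1 m2 : M, m1 != m2.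
  have /card_gt1P[m1 [m2 [_ _ m12]]] : (1 < #|M|)%N.
    by apply: leq_trans (card_messages G); rewrite card_ord.
  by exists m1, m2.
exists (split_message m1 m2 (Itv01 a0 a1)), (split_proposal m1 x y).
exact: split_equilibrium.
Qed.
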